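(* Let $X$ be a separable topological space and let $F\colon X\times X\to(0,+\infty)$ satisfy $$F(x,z)\ge F(x,y)\cdot F(y,z),\quad x,y,z\in X.$$ Assume that $F$ is continuous at every point of $\Delta=\{(x,x):x\in X\}$ and equal to $1$ at every point of $\Delta$. Then $$F(a,b)=\inf\left\{\frac{f(a)}{f(b)}: f\in\mathcal{F}(F)\right\},\quad a,b\in X.$$ Conversely, for an arbitrary family $\mathcal{F}$ of functions $f\colon X\to(0,+\infty)$, every mapping $F\colon X\times X\to(0,+\infty)$ defined by $$F(a,b)=\inf\left\{\frac{f(a)}{f(b)}: f\in\mathcal{F}\right\},\quad a,b\in X$$ (that is, whenever these infima all lie in $(0,+\infty)$), satisfies $F(x,z)\ge F(x,y)\cdot F(y,z)$ for all $x,y,z\in X$, is equal to $1$ on $\Delta$, and $\mathcal{F}\subseteq\mathcal{F}(F)$.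
   Context: For a map $F\colon X\times X\to(0,+\infty)$, $$\mathcal{F}(F)=\left\{f\colon X\to(0,+\infty)\ :\ \frac{f(x)}{f(y)}\ge F(x,y)\ \text{for all } x,y\in X\right\}.$$ $X\times X$ carries the product topology. A topological space is separable if it has a countable dense subset. *)

(* Defs.v *)
From HB Require Import structures.
From mathcomp Require Import all_boot all_order all_algebra.
From mathcomp Require Import all_classical all_reals all_analysis.
Import Order.TTheory GRing.Theory Num.Theory.
Import numFieldNormedType.Exports.

Set Implicit Arguments.
Unset Strict Implicit.
Unset Printing Implicit Defensive.

Local Open Scope classical_set_scope.
Local Open Scope ring_scope.

(* Maps into (0, +oo) are real-valued maps together with this positivity
   predicate. *)
Definition positive_map (T : Type) (R : realType) (f : T -> R) : Prop :=
  forall t, 0 < f t.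

(* [countable] includes the finite (and empty) sets. *)
Definition separable_space (X : topologicalType) : Prop :=
  exists2 D : set X, countable D & dense D.

Definition supermultiplicative (X : Type) (R : realType) (F : X * X -> R)
  : Prop :=
  forall x y z, F (x, z) >= F (x, y) * F (y, z).

Definition ratio_family (X : Type) (R : realType) (F : X * X -> R)
  : set (X -> R) :=
  [set f | positive_map f /\ forall x y, f x / f y >= F (x, y)].

(* The infimum is taken in the extended reals, so that the infimum over an
   empty family is +oo; an equation (F (a, b))%:E = inf_ratio S a b therefore
   includes the finiteness of the infimum. *)
Definition inf_ratio (X : Type) (R : realType) (S : set (X -> R)) (a b : X)
  : \bar R :=
  ereal_inf [set (f a / f b)%:E | f in S].

(* Main.v *)
Require Import Defs.
From HB Require Import structures.
From mathcomp Require Import all_boot all_order all_algebra.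
From mathcomp Require Import all_classical all_reals all_analysis.
Import Order.TTheory GRing.Theory Num.Theory.
Import numFieldNormedType.Exports.
Local Open Scope classical_set_scope.
Local Open Scope ring_scope.


(** For a supermultiplicative [F] that equals [1] on the diagonal the infimum
    is a minimum: at the pair [(a, b)] it is attained by the section
    [x |-> F (x, b)].  Indeed [F (x, y) * F (y, b) <= F (x, b)] says exactly
    that this section has ratios dominating [F], and [F (b, b) = 1] makes its
    own ratio at [(a, b)] equal to [F (a, b)].  The other inequality is the
    definition of the family.

    Conversely, ratios of one function satisfy
    [(f x / f y) * (f y / f z) = f x / f z] and [f x / f x = 1]; the first
    identity becomes an inequality after taking infima, and the second one
    survives because finiteness of the infimum forces the family to be
    nonempty. *)

Section Ratios.
Variables (X : Type) (R : realType).
Implicit Types (F : X * X -> R) (f : X -> R) (S : set (X -> R)).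

Lemma section_ratio_family F (b : X) :
  positive_map F -> supermultiplicative F ->
  ratio_family F (fun x => F (x, b)).
Proof.
move=> Fpos Fsup; split=> [x|x y]; first exact: Fpos.
by rewrite ler_pdivlMr ?Fpos//; exact: Fsup.
Qed.

Lemma ratio_family_inf F (a b : X) :
  positive_map F -> supermultiplicative F -> F (b, b) = 1 ->
  (F (a, b))%:E = inf_ratio (ratio_family F) a b.
Proof.
move=> Fpos Fsup Fbb; apply/eqP; rewrite eq_le; apply/andP; split.
  by apply: le_ereal_inf_tmp => _ [f [_ fF] <-]; rewrite lee_fin.
apply: ereal_inf_lbound; exists (fun x => F (x, b)).
  exact: section_ratio_family.
by rewrite Fbb divr1.
Qed.

Section RealInfimum.
Variables (S : set (X -> R)) (F : X * X -> R).
Hypothesis Spos : forall f, S f -> positive_map f.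
Hypothesis infF : forall a b : X, (F (a, b))%:E = inf_ratio S a b.

Lemma inf_ratio_le f (a b : X) : S f -> F (a, b) <= f a / f b.
Proof.
by move=> Sf; rewrite -lee_fin infF; apply: ereal_inf_lbound; exists f.
Qed.

Lemma sub_ratio_family : S `<=` ratio_family F.
Proof.
by move=> f Sf; split=> [|x y]; [exact: Spos|exact: inf_ratio_le].
Qed.

Lemma inf_ratio_supermultiplicative :
  positive_map F -> supermultiplicative F.
Proof.
move=> Fpos x y z; rewrite -lee_fin infF.
apply: le_ereal_inf_tmp => _ [f Sf <-]; rewrite lee_fin.
have fy0 : f y != 0 by rewrite gt_eqF// Spos.
have -> : f x / f z = (f x / f y) * (f y / f z) by rewrite mulrA divfK.
by apply: ler_pM; rewrite ?inf_ratio_le// ltW.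
Qed.

(** The infimum of the empty set is [+oo], so an empty family cannot have a
    real infimum. *)
Lemma inf_ratio_nonempty (x : X) : S !=set0.
Proof.
apply/set0P/eqP => S0; have := infF x x.
by rewrite /inf_ratio S0 image_set0 ereal_inf0.
Qed.

Lemma inf_ratio_diag (x : X) : F (x, x) = 1.
Proof.
have ratio1 f : S f -> f x / f x = 1.
  by move=> Sf; rewrite divff// gt_eqF// Spos.
apply/eqP; rewrite eq_le; apply/andP; split.
  have [f Sf] := inf_ratio_nonempty x.
  by rewrite -(ratio1 f Sf) inf_ratio_le.
rewrite -lee_fin infF.
by apply: le_ereal_inf_tmp => _ [f Sf <-]; rewrite ratio1.
Qed.

End RealInfimum.
End Ratios.

Theorem corollary3 (R : realType) (X : topologicalType)
    (sepX : separable_space X) :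
  (forall F : X * X -> R,
     positive_map F ->
     supermultiplicative F ->
     (forall x : X, {for (x, x), continuous F}) ->
     (forall x : X, F (x, x) = 1) ->
     forall a b : X, (F (a, b))%:E = inf_ratio (ratio_family F) a b)
  /\
  (forall (S : set (X -> R)) (F : X * X -> R),
     (forall f, S f -> positive_map f) ->
     positive_map F ->
     (forall a b : X, (F (a, b))%:E = inf_ratio S a b) ->
     [/\ supermultiplicative F,
         (forall x : X, F (x, x) = 1)
       & S `<=` ratio_family F]).
Proof.
split=> [F Fpos Fsup _ F1 a b|S F Spos Fpos infF].
  exact: ratio_family_inf.
split.
- exact: inf_ratio_supermultiplicative infF Fpos.
- exact: inf_ratio_diag infF.
- exact: sub_ratio_family infF.
Qed.
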